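(* Let $\mathfrak{s},\mathfrak{t}$ be nonnegative Hermitian forms on a complex vector space $\mathscr{D}$. The following statements are equivalent: (i) $\mathfrak{s}$ is absolutely continuous with respect to $\mathfrak{t}$; (ii) there is a positive selfadjoint (not necessarily bounded) operator $S$ in $\mathfrak{H}_{\mathfrak{t}}$ such that $\mathscr{D}\subseteq\operatorname{dom}S^{1/2}$ and $$(S^{1/2}x\,|\,S^{1/2}y)_{\mathfrak{t}}=\mathfrak{s}(x,y)\qquad\text{for all } x,y\in\mathscr{D}.$$
   Context: For a nonnegative Hermitian form $\mathfrak{t}$ on $\mathscr{D}$ (linear in the first variable), put $\mathscr{N}_{\mathfrak{t}}=\{x\in\mathscr{D}:\mathfrak{t}(x,x)=0\}$. The Hilbert space $\mathfrak{H}_{\mathfrak{t}}$ is the completion of $\mathscr{D}/\mathscr{N}_{\mathfrak{t}}$ with respect to the inner product $(x+\mathscr{N}_{\mathfrak{t}}\,|\,y+\mathscr{N}_{\mathfrak{t}})_{\mathfrak{t}}=\mathfrak{t}(x,y)$. For $x\in\mathscr{D}$ one writes $x$ also for the class $x+\mathscr{N}_{\mathfrak{t}}\in\mathfrak{H}_{\mathfrak{t}}$; accordingly, $\mathscr{D}\subseteq\operatorname{dom}S^{1/2}$ means that all these classes belong to $\operatorname{dom}S^{1/2}$. The form $\mathfrak{s}$ is absolutely continuous with respect to $\mathfrak{t}$ if for every sequence $(x_n)_{n\in\mathbb{N}}$ in $\mathscr{D}$, the conditions $\mathfrak{t}(x_n,x_n)\to0$ and $\mathfrak{s}(x_n-x_m,x_n-x_m)\to0$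 (as $n,m\to\infty$) imply $\mathfrak{s}(x_n,x_n)\to0$. *)

(* Defs.v *)
From HB Require Import structures.
From mathcomp Require Import all_boot all_order all_algebra.
From mathcomp Require Import complex.
From mathcomp Require Import all_classical all_reals all_analysis.

Set Implicit Arguments.
Unset Strict Implicit.
Unset Printing Implicit Defensive.

Import Order.TTheory GRing.Theory Num.Theory.
Import numFieldNormedType.Exports.

Local Open Scope classical_set_scope.
Local Open Scope ring_scope.
Local Open Scope complex_scope.

(* [{hermitian D for false & conjC}]: sesquilinear, linear in the first
   variable, with [f x y = conjC (f y x)]. *)
Notation hermitian_form D := {hermitian D for false & @Num.conj _}.

Definition nonneg_form (R : realType) (D : lmodType R[i])
    (f : hermitian_form D) : Prop :=
  forall x : D, 0 <= f x x.

(* The diagonal values of a Hermitian form are real; [qf f x] is [f x x] as an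
   element of [R]. *)
Definition qf (R : realType) (D : lmodType R[i])
    (f : hermitian_form D) (x : D) : R :=
  complex.Re (f x x).

Definition abs_continuous (R : realType) (D : lmodType R[i])
    (s t : hermitian_form D) : Prop :=
  forall u : nat -> D,
    (qf t (u n) @[n --> \oo] --> (0 : R)) ->
    (qf s (u nm.1 - u nm.2) @[nm --> (\oo, \oo)] --> (0 : R)) ->
    (qf s (u n) @[n --> \oo] --> (0 : R)).

(* A complex Hilbert space: a complete normed space whose norm comes from an
   inner product (linear in the first variable). *)
Record hilbertType (R : realType) := Hilbert {
  hilbert_sort :> completeNormedModType R[i];
  inner : {dot hilbert_sort for @Num.conj _};
  inner_norm : forall x : hilbert_sort, inner x x = `|x| ^+ 2
}.
Arguments inner {R h}.

(* [H] together with [j] is the Hilbert space completion of [D / N_t], where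
   [N_t = {x | t x x = 0}]: [j] is the composition of [D -> D / N_t] with the
   isometric embedding of [D / N_t] onto a dense subspace of [H]. The first clause
   makes [N_t] the kernel of [j]; [H] is unique up to a unitary operator
   compatible with the maps [j]. *)
Definition is_form_completion (R : realType) (D : lmodType R[i])
    (t : hermitian_form D) (H : hilbertType R) (j : {linear D -> H}) : Prop :=
  (forall x y : D, inner (j x) (j y) = t x y) /\ dense (range j).

(* A possibly unbounded, not necessarily densely defined linear operator in
   [H]; the values of [op_fun] outside [op_dom] are irrelevant. *)
Record operator (R : realType) (H : hilbertType R) := Operator {
  op_dom : set H;
  op_fun :> H -> H;
  op_dom0 : op_dom 0;
  op_domP : forall (a : R[i]) (x y : H),
    op_dom x -> op_dom y -> op_dom (a *: x + y);
  op_linear : forall (a : R[i]) (x y : H),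
    op_dom x -> op_dom y -> op_fun (a *: x + y) = a *: op_fun x + op_fun y
}.

Definition op_graph (R : realType) (H : hilbertType R) (A : operator H) :
    set (H * H) :=
  [set p | op_dom A p.1 /\ A p.1 = p.2].

Definition adjoint_graph (R : realType) (H : hilbertType R) (A : operator H) :
    set (H * H) :=
  [set p | forall x : H, op_dom A x -> inner (A x) p.1 = inner x p.2].

Definition selfadjoint (R : realType) (H : hilbertType R) (A : operator H) :
    Prop :=
  dense (op_dom A) /\ adjoint_graph A = op_graph A.

Definition positive_op (R : realType) (H : hilbertType R) (A : operator H) :
    Prop :=
  forall x : H, op_dom A x -> 0 <= inner (A x) x.

Definition positive_selfadjoint (R : realType) (H : hilbertType R)
    (A : operator H) : Prop :=
  selfadjoint A /\ positive_op A.

Definition comp_graph (R : realType) (H : hilbertType R) (A B : operator H) :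
    set (H * H) :=
  [set p | [/\ op_dom B p.1, op_dom A (B p.1) & A (B p.1) = p.2]].

(* [B] is [A^{1/2}]. A positive selfadjoint [A] has exactly one such square
   root, up to the irrelevant values of [op_fun B] outside [op_dom B]. *)
Definition is_sqrt_op (R : realType) (H : hilbertType R) (A B : operator H) :
    Prop :=
  positive_selfadjoint B /\ comp_graph B B = op_graph A.

(* Main.v *)
(* Let [q = s + t] on [D]. If [s] is absolutely continuous with respect to [t],
   the embedding of the completion of [(D, q)] into [Ht] is injective, and the
   operator [B] on [Ht] with [q (B h) y = (h, j y)] is a symmetric injective
   operator with [0 <= B <= 1]; it is [(1 + S)^-1]. With [P = B^{1/2}] and
   [Q = (1 - B)^{1/2}], which commute and satisfy [P^2 + Q^2 = 1], the wanted
   operators are the graphs [S = {(B z, z - B z)}] and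
   [S^{1/2} = {(P z, Q z)}], whose selfadjointness and composition are checked
   algebraically. The completion of [(D, q)] is never formed: its elements are
   replaced by approximate Riesz representatives in [D]. Conversely, a
   selfadjoint square root is closed, so [j u_n -> 0] and convergence of
   [S^{1/2} j u_n] force the latter limit to be [0]. *)
From HB Require Import structures.
Require Import Defs.
From mathcomp Require Import all_boot all_order all_algebra.
From mathcomp Require Import complex.
From mathcomp Require Import all_classical all_reals all_analysis.
From mathcomp Require Import ring lra.

Set Implicit Arguments.
Unset Strict Implicit.
Unset Printing Implicit Defensive.

Import Order.TTheory GRing.Theory Num.Theory.
Import numFieldNormedType.Exports.

Local Open Scope ring_scope.
Local Open Scope complex_scope.

(** * Real inequalities and the rate 1/(n+1) *)

Section Reals.
Variable R : realType.
Implicit Types (X Y p c : R) (n : nat).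

(* The discriminant inequality behind both Cauchy-Schwarz and the estimate for
   approximate minimizers in [riesz_approx]. *)
Lemma young_optimal X Y p : 0 <= X -> 0 <= Y ->
  (forall c, 2 * c * p <= c ^+ 2 * X ^+ 2 + Y ^+ 2) -> p <= X * Y.
Proof.
move=> X0 Y0 H; have [//|lt_p] := leP p (X * Y).
have p0 : 0 < p by apply: le_lt_trans lt_p; apply: mulr_ge0.
move: X0; rewrite le_eqVlt => /predU1P[X0|X0].
  (* For X = 0 this c turns the hypothesis into 2(Y^2 + 1) <= Y^2. For X > 0 the value c = p/X^2
     used next is the optimal one. *)
  have := H ((Y ^+ 2 + 1) / p).
  rewrite -X0 expr0n /= mulr0 add0r -mulrA divfK ?gt_eqF//.
  by have := sqr_ge0 Y; lra.
have := H (p / X ^+ 2).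
have X2 : X ^+ 2 != 0 by rewrite expf_neq0 ?gt_eqF.
have -> : 2 * (p / X ^+ 2) * p = 2 * (p / X) ^+ 2.
  by field; rewrite gt_eqF.
have -> : (p / X ^+ 2) ^+ 2 * X ^+ 2 = (p / X) ^+ 2.
  by field; rewrite gt_eqF.
move=> h; have {h} : (p / X) ^+ 2 <= Y ^+ 2 by lra.
have pX : 0 <= p / X by rewrite divr_ge0 ?(ltW p0) ?(ltW X0).
by rewrite ler_sqr ?nnegrE// ler_pdivrMr// mulrC leNgt lt_p.
Qed.

Definition recipS n : R := n.+1%:R^-1.

(** Replaces most passages to the limit: an inequality is proved up to an error of order 1/(n+1),
    with c collecting the constants. *)
Lemma le_of_recipS_bound (x y c : R) :
  (forall n, x <= y + c * recipS n) -> x <= y.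
Proof.
move=> H; apply/ler_addgt0Pr => e e0.
have [n hn] : exists n, `|c| / e < n%:R.
  by exists (Num.bound (`|c| / e)); apply: archi_boundP; rewrite divr_ge0// ltW.
apply: le_trans (H n) _; rewrite /recipS lerD2l ler_pdivrMr//.
apply: le_trans (ler_norm _) _; rewrite mulrC -ler_pdivrMr//.
by apply: le_trans (ltW hn) _; rewrite ler_nat.
Qed.

Lemma recipS_gt0 n : 0 < recipS n. Proof. by rewrite /recipS invr_gt0. Qed.

Lemma recipS_le1 n : recipS n <= 1.
Proof. by rewrite /recipS invf_le1// ler1n. Qed.

Lemma recipS_le (N n : nat) : (N <= n)%N -> recipS n <= recipS N.
Proof. by move=> h; rewrite /recipS lef_pV2 ?posrE// ler_nat. Qed.

End Reals.
Arguments recipS {R}.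

(** * Nonnegative forms and approximate Riesz representation *)

Section SemidefiniteForms.
Variables (R : realType) (E : lmodType R[i]).

(* [psd q] axiomatizes the real part of a nonnegative Hermitian form. *)
Record psd (q : E -> E -> R) : Prop := Psd {
  psdDl : forall x y z, q (x + y) z = q x z + q y z;
  psdZl : forall (a : R) x y, q (a%:C *: x) y = a * q x y;
  psdJ : forall (a : R[i]) x y, q (a *: x) y = q x (Num.conj a *: y);
  psdC : forall x y, q x y = q y x;
  psd_ge0 : forall x, 0 <= q x x }.

Definition snorm (q : E -> E -> R) (x : E) : R := Num.sqrt (q x x).

Variable q : E -> E -> R.
Hypothesis hq : psd q.
Local Notation N := (snorm q).

Lemma psdDr x y z : q z (x + y) = q z x + q z y.
Proof. by rewrite !(psdC hq z) psdDl. Qed.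

Lemma psdZr (a : R) x y : q x (a%:C *: y) = a * q x y.
Proof. by rewrite !(psdC hq x) psdZl. Qed.

Lemma psdNl x y : q (- x) y = - q x y.
Proof. by rewrite -scaleN1r -(mulN1r (q x y)) -psdZl// rmorphN1. Qed.

Lemma psdNr x y : q y (- x) = - q y x.
Proof. by rewrite !(psdC hq y) psdNl. Qed.

Lemma psdBl x y z : q (x - y) z = q x z - q y z.
Proof. by rewrite psdDl// psdNl. Qed.

Lemma psdBr x y z : q z (x - y) = q z x - q z y.
Proof. by rewrite psdDr psdNr. Qed.

Lemma psd0l x : q 0 x = 0.
Proof. by have := psdBl x x x; rewrite !subrr. Qed.

Lemma psd0r x : q x 0 = 0.
Proof. by rewrite psdC// psd0l. Qed.

Lemma snorm_ge0 x : 0 <= N x. Proof. exact: sqrtr_ge0. Qed.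

Lemma sqr_snorm x : N x ^+ 2 = q x x.
Proof. by rewrite sqr_sqrtr ?psd_ge0. Qed.

Lemma psd_young x y : 2 * q x y <= q x x + q y y.
Proof.
have := psd_ge0 hq (x - y); rewrite psdBl !psdBr (psdC hq y x); lra.
Qed.

Lemma cauchy_schwarz x y : q x y <= N x * N y.
Proof.
apply: young_optimal; rewrite ?snorm_ge0// => c; rewrite !sqr_snorm.
by have := psd_young (c%:C *: x) y; rewrite !psdZl// psdZr; lra.
Qed.

Lemma snormN x : N (- x) = N x.
Proof. by rewrite /snorm psdNl psdNr opprK. Qed.

Lemma cauchy_schwarz_abs x y : `|q x y| <= N x * N y.
Proof.
by rewrite ler_norml cauchy_schwarz lerNl -psdNl -(snormN x) cauchy_schwarz.
Qed.

Lemma snormBC x y : N (x - y) = N (y - x).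
Proof. by rewrite -snormN opprB. Qed.

Lemma snorm0 : N 0 = 0. Proof. by rewrite /snorm psd0l sqrtr0. Qed.

Lemma snormD x y : N (x + y) <= N x + N y.
Proof.
rewrite -ler_sqr ?nnegrE ?addr_ge0 ?snorm_ge0// sqr_snorm psdDl// !psdDr.
by rewrite (psdC hq y x) -!sqr_snorm; have := cauchy_schwarz x y; lra.
Qed.

Lemma snormB x y : N (x - y) <= N x + N y.
Proof. by rewrite -(snormN y) snormD. Qed.

Lemma snorm_dist x y z : N (x - z) <= N (x - y) + N (y - z).
Proof. by apply: le_trans (snormD _ _); rewrite addrA subrK. Qed.

Lemma snormZ (a : R[i]) x : N (a *: x) = complex.Re `|a| * N x.
Proof.
rewrite /snorm psdJ// scalerA mulrC -normCK.
have r : (complex.Re `|a|)%:C = `|a| by apply: RRe_real; rewrite normr_real.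
rewrite -r -rmorphXn /= psdZr// sqrtrM ?sqr_ge0// sqrtr_sqr ger0_norm//.
by rewrite -ler0c r.
Qed.

Lemma snorm_scale (a : R) x : 0 <= a -> N (a%:C *: x) = a * N x.
Proof. by move=> a0; rewrite snormZ ger0_norm// ler0c. Qed.

(* [represents f v e]: up to an error of norm [e], the vector [v] is the Riesz
   representative of the functional [f] in the completion of [(E, q)]. *)
Definition represents (f : E -> R) (v : E) (e : R) : Prop :=
  forall y, q v y - f y <= e * N y.

(** Testing with y = v gives |v|^2 <= (C + e)|v|; the case |v| = 0 is covered by the sign of C +
    e. *)
Lemma represents_snorm f v e C : represents f v e ->
  (forall y, f y <= C * N y) -> 0 <= C + e -> N v <= C + e.
Proof.
move=> hv hf h0; have := hv v; have := hf v; rewrite -sqr_snorm.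
have := snorm_ge0 v; rewrite le_eqVlt => /predU1P[<-//|N0] h1 h2.
by rewrite -(ler_pM2r N0); lra.
Qed.

(** The conjugate comes from moving a to the second argument of q; for f = (h, .) the new functional
    is that of a h plus g. *)
Lemma represents_linear f g v w (a : R[i]) e d :
  represents f v e -> represents g w d ->
  represents (fun y => f (Num.conj a *: y) + g y) (a *: v + w)
    (complex.Re `|a| * e + d).
Proof.
move=> hv hw y; rewrite psdDl// psdJ//.
have := hv (Num.conj a *: y); have := hw y.
by rewrite snormZ norm_conjC; lra.
Qed.

(** [represents] is one-sided, so the estimate for w is used at -y; hence g has to be odd. *)
Lemma representsB f g v w e d :
  (forall y, g (- y) = - g y) -> represents f v e -> represents g w d ->
  represents (fun y => f y - g y) (v - w) (e + d).
Proof.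
move=> gN hv hw y; have := hv y; have := hw (- y).
by rewrite gN snormN psdNr psdBl; lra.
Qed.

(* Approximate minimizers of [q y y - 2 * f y] represent [f] approximately;
   no completeness is needed. *)
Lemma riesz_approx (f : E -> R) (C e : R) :
  (forall x y, f (x + y) = f x + f y) ->
  (forall (a : R) x, f (a%:C *: x) = a * f x) ->
  (forall y, f y <= C * N y) -> 0 < e -> exists v, represents f v e.
Proof.
move=> fD fZ fC e0.
pose J y := q y y - 2 * f y; pose A : set R := range J.
(* Completing the square: |y|^2 - 2C|y| >= -C^2. *)
have Jlb y : - (C ^+ 2) <= J y.
  rewrite /J -sqr_snorm; have := sqr_ge0 (C - N y); have := fC y; nra.
have hA : has_inf A.
  split; first by exists (J 0), 0.
  by exists (- (C ^+ 2)) => _ [y _ <-].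
(* With J v < inf J + e^2, comparing J v and J (v - c y) gives 2c(q v y - f y) <= c^2 |y|^2 + e^2
   for every real c. *)
have [_ [v _ <-] Jv] := inf_adherent (exprn_gt0 2 e0) hA.
exists v => y; rewrite mulrC; apply: young_optimal; rewrite ?snorm_ge0 ?ltW//.
move=> c.
have : inf A <= J (v + (- c)%:C *: y).
  by apply: ge_inf; [exact: hA.2 | exists (v + (- c)%:C *: y)].
rewrite sqr_snorm; move: Jv.
rewrite /J !psdDl// !psdDr !psdZr !psdZl// !fD !fZ (psdC hq y v).
lra.
Qed.

End SemidefiniteForms.

Lemma psd_hermitian (R : realType) (D : lmodType R[i]) (f : hermitian_form D) :
  nonneg_form f -> psd (fun x y => complex.Re (f x y)).
Proof.
move=> f0; split.
- move=> x y z; have -> : f (x + y) z = f x z + f y z by exact: linearDl.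
  by case: (f x z) (f y z) => [? ?] [].
- move=> a x y; have -> : f (a%:C *: x) y = a%:C * f x y by exact: linearZl_LR.
  by case: (f x y) => u v /=; rewrite mul0r subr0.
- move=> a x y; have -> : f (a *: x) y = a * f x y by exact: linearZl_LR.
  suff -> : f x (Num.conj a *: y) = a * f x y by [].
  by rewrite -[in RHS](conjCK a); exact: linearZr_LR.
- by move=> x y; rewrite hermC expr0 mul1r; case: (f y x).
- by move=> x; have := f0 x; rewrite lecE => /andP[].
Qed.

Lemma complex_eq_Re (R : realType) (z w : R[i]) :
  complex.Re z = complex.Re w ->
  complex.Re ('i * z) = complex.Re ('i * w) -> z = w.
Proof.
case: z w => [a b] [c d] /= ->.
by rewrite !mul0r !mul1r !add0r => /oppr_inj ->.
Qed.

(** * Hilbert spaces *)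

Section HilbertSpaces.
Local Open Scope classical_set_scope.
Local Open Scope ring_scope.
Variables (R : realType) (H : hilbertType R).
Implicit Types (x y h l : H).

Definition rinner x y : R := complex.Re (inner x y).

Local Notation nr := (snorm rinner).

Lemma psd_rinner : psd rinner.
Proof. apply: (@psd_hermitian _ _ inner) => x.
by have := exprn_ge0 2 (normr_ge0 x); rewrite -inner_norm. Qed.

Local Notation hr := psd_rinner.

(** The norm of [H] takes values in [R[i]]; estimates are carried out with its real counterpart. *)
Lemma normE x : `|x| = (nr x)%:C.
Proof.
have h : (complex.Re `|x|)%:C = `|x| by apply: RRe_real; rewrite normr_real.
rewrite /snorm /rinner inner_norm -h -rmorphXn /= sqrtr_sqr ger0_norm//.
by rewrite -ler0c h.
Qed.

Lemma nr_eq0 x : nr x = 0 -> x = 0.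
Proof. by move=> h; apply/eqP; rewrite -normr_eq0 normE h. Qed.

Lemma rinner_eq0 x : (forall y, rinner x y = 0) -> x = 0.
Proof. by move=> h; apply: nr_eq0; rewrite /snorm h sqrtr0. Qed.

Lemma nr_eq0_lim x (c : R) : (forall n, nr x <= c * recipS n) -> x = 0.
Proof.
move=> h; apply: nr_eq0; apply/eqP; rewrite eq_le snorm_ge0 andbT.
by apply: (@le_of_recipS_bound _ _ _ c) => n; rewrite add0r.
Qed.

Lemma denseP (A : set H) :
  dense A <-> forall h (e : R), 0 < e -> exists2 x, A x & nr (x - h) < e.
Proof.
split=> [dA h e e0|hA O [h Oh] oO].
  have [] := dA (ball h e%:C).
  - by exists h; apply: ballxx; rewrite ltcR.
  - by apply: ball_open; rewrite ltcR.
  move=> x [+ Ax]; rewrite -ball_normE /ball_/= normE ltcR => hx.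
  by exists x => //; rewrite snormBC//; exact: hr.
have /nbhs_ballP[e /= e0 he] : nbhs h O by exact: open_nbhs_nbhs.
have eE : (complex.Re e)%:C = e by apply: RRe_real; rewrite gtr0_real.
have e0' : 0 < complex.Re e by rewrite -ltcR eE.
have [x Ax hx] := hA h _ e0'; exists x; split=> //; apply: he.
by rewrite -ball_normE /ball_/= normE -eE ltcR snormBC//; exact: hr.
Qed.

Lemma hilbert_complete (u : nat -> H) :
  (forall e : R, 0 < e ->
    exists n, forall m, (n <= m)%N -> nr (u n - u m) < e) ->
  exists l, forall e : R, 0 < e ->
    exists n, forall m, (n <= m)%N -> nr (u m - l) < e.
Proof.
move=> hu; have /cauchy_cvg/cvg_ex[l ul] : cauchy (u @ \oo).
  apply: cauchy_exP => e e0.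
  have eE : (complex.Re e)%:C = e by apply: RRe_real; rewrite gtr0_real.
  have [|n hn] := hu (complex.Re e); first by rewrite -ltcR eE.
  exists (u n); exists n => // m /hn.
  by rewrite /= -ball_normE /ball_/= normE -eE ltcR.
exists l => e e0.
have /cvgrPdist_lt/(_ e%:C) := ul; rewrite ltcR => /(_ e0)[n _ hn].
exists n => m /hn /=; rewrite normE ltcR snormBC//; exact: hr.
Qed.

(** Letting m tend to infinity in the Cauchy estimate keeps the explicit rate for the distance to
    the limit. *)
Lemma hilbert_complete_rate (u : nat -> H) (c : R) :
  (forall m n, nr (u m - u n) <= c * recipS m + c * recipS n) ->
  exists l, forall n, nr (u n - l) <= c * recipS n.
Proof.
move=> hu; have c0 : 0 <= c.
  by have := hu 0%N 0%N; rewrite subrr (snorm0 hr); have := recipS_gt0 R 0; nra.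
have [|l hl] := hilbert_complete (u := u).
  move=> e e0.
  have hb : exists n, c * recipS n + c * recipS n < e.
    apply: contrapT => /forallNP h.
    have : e <= 0; last by rewrite leNgt e0.
    apply: (@le_of_recipS_bound _ _ _ (c + c)) => n.
    by rewrite add0r mulrDl leNgt; apply/negP/h.
  have [n hn] := hb; exists n => m nm; apply: le_lt_trans (hu _ _) _.
  apply: le_lt_trans hn; rewrite lerD2l ler_wpM2l//; exact: recipS_le.
exists l => n; apply/ler_addgt0Pr => e e0.
apply: (@le_of_recipS_bound _ _ _ c) => k.
have [N hN] := hl _ e0.
have := hN _ (leq_maxl N k); have := hu n (maxn N k).
have := snorm_dist hr (u n) (u (maxn N k)) l.
have : c * recipS (maxn N k) <= c * recipS k.
  by rewrite ler_wpM2l// recipS_le// leq_maxr.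
lra.
Qed.

End HilbertSpaces.

(** * Square roots of bounded positive operators *)

Section SquareRoot.
Variables (R : realType) (H : hilbertType R).
Local Notation ri := (@rinner R H).
Local Notation nr := (snorm ri).
Local Notation hr := (@psd_rinner R H).

Lemma linear_of_fun (f : H -> H) :
  linear f -> exists L : {linear H -> H}, L =1 f.
Proof.
move=> lf; pose m := GRing.isLinear.Build R[i] H H *:%R f lf.
by exists (HB.pack f m : {linear H -> H}).
Qed.

Lemma linear_sub_id (F : {linear H -> H}) :
  exists G : {linear H -> H}, forall x, G x = x - F x.
Proof.
apply: linear_of_fun => a x y.
by rewrite linearP /= scalerBr opprD addrACA.
Qed.

Definition symmetric_map (P : H -> H) := forall x y, ri (P x) y = ri x (P y).

Definition bounded_map (P : H -> H) :=
  exists2 M : R, 0 <= M & forall x, nr (P x) <= M * nr x.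

Definition commutes (P C : H -> H) := forall x, P (C x) = C (P x).

(** Real parts determine a complex-linear identity: replacing x by ix yields the imaginary parts. *)
Lemma inner_symmetric (P : {linear H -> H}) : symmetric_map P ->
  forall x y, inner (P x) y = inner x (P y).
Proof.
move=> sP x y; apply: complex_eq_Re; first exact: sP.
have e u v : 'i * inner u v = inner ('i *: u) v :> R[i] by rewrite -linearZl_LR.
by rewrite !e -linearZ; exact: sP.
Qed.

(** * Iterative construction of the square root of 1 - A for a symmetric contraction A *)

Section Iteration.
Variable A : {linear H -> H}.
Hypotheses (sA : symmetric_map A) (cA : forall x, nr (A x) <= nr x).

(** A fixed point X of X = (A + X^2)/2 satisfies (1 - X)^2 = 1 - A. *)
Fixpoint sqrt_iter n (h : H) : H :=
  if n is n.+1 then (2^-1)%:C *: (A h + sqrt_iter n (sqrt_iter n h)) else 0.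

(* The same recursion for scalars, with [A] replaced by [1]: it bounds the
   norms and the increments of [sqrt_iter]. *)
Fixpoint sqrt_iter1 n : R :=
  if n is n.+1 then 2^-1 * (1 + sqrt_iter1 n ^+ 2) else 0.

Local Notation X := sqrt_iter.
Local Notation r := sqrt_iter1.

Lemma sqrt_iter_linear n : linear (X n).
Proof.
elim: n => [|n IH] a x y /=; first by rewrite scaler0 addr0.
rewrite linearP !IH scalerA mulrC -scalerA -scalerDr; congr (_ *: _).
by rewrite scalerDr addrACA.
Qed.

Lemma sqrt_iterB n x y : X n (x - y) = X n x - X n y.
Proof.
by have := sqrt_iter_linear n (-1) y x; rewrite !scaleN1r !(addrC (- _)).
Qed.

Lemma sqrt_iterD n x y : X n (x + y) = X n x + X n y.
Proof. by have := sqrt_iter_linear n 1 x y; rewrite !scale1r. Qed.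

Lemma sqrt_iterZ n a x : X n (a *: x) = a *: X n x.
Proof.
have := sqrt_iter_linear n a x 0; rewrite !addr0 => ->.
suff -> : X n 0 = 0 by rewrite addr0.
by have := sqrt_iterB n 0 0; rewrite !subrr.
Qed.

Lemma sqrt_iter_commute n (C : {linear H -> H}) :
  commutes A C -> commutes (X n) C.
Proof.
move=> AC; elim: n => [|n IH] x /=; first by rewrite linear0.
by rewrite [in RHS]linearZ [in RHS]linearD /= AC !IH.
Qed.

Lemma sqrt_iter_comm m n : commutes (X m) (X n).
Proof.
elim: n => [|n IH] x /=; first by have := sqrt_iterB m 0 0; rewrite !subrr.
rewrite sqrt_iterZ sqrt_iterD !IH; congr (_ *: (_ + _)).
by apply: (@sqrt_iter_commute m A).
Qed.

Lemma sqrt_iter_symmetric n : symmetric_map (X n).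
Proof.
elim: n => [|n IH] x y /=; first by rewrite (psd0l hr) (psd0r hr).
by rewrite (psdZl hr) (psdZr hr) (psdDl hr) (psdDr hr) sA !IH.
Qed.

(** The defect d = 1 - r obeys the recursion d' = d - d^2/2, whose solutions decay like 2/n. *)
Lemma sqrt_iter1_bounds n : 0 <= r n <= 1 /\ 1 - r n <= 2 * recipS n.
Proof.
elim: n => [|n [/andP[r0 r1] IH]] /=.
  by rewrite /recipS invr1 lexx ler01 subr0 mulr1 ler1n.
split; first by apply/andP; split; nra.
set d := 1 - r n in IH.
have -> : 1 - 2^-1 * (1 + r n ^+ 2) = d - 2^-1 * d ^+ 2 by rewrite /d; field.
have d0 : 0 <= d <= 1 by apply/andP; split; rewrite /d; lra.
have ? : 0 < n.+1%:R :> R by rewrite ltr0n.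
have e : recipS n.+1 = recipS n / (1 + recipS n) :> R.
  rewrite /recipS -[n.+2]addn1 natrD; field.
  by apply/andP; split; rewrite gt_eqF//; lra.
have [t0 t1] := (recipS_gt0 R n, recipS_le1 R n).
rewrite e; set t := recipS n in IH t0 t1 *.
rewrite mulrA ler_pdivlMr; last by lra.
have [d1 d2] := andP d0.
(* If 2t <= 1, the map x - x^2/2 is increasing on [0,1] and d <= 2t can be inserted; otherwise d -
   d^2/2 <= 1/2 is enough. *)
have [ht|ht] := leP (2 * t) 1.
  have : d - 2^-1 * d ^+ 2 <= 2 * t - 2^-1 * (2 * t) ^+ 2 by nra.
  nra.
nra.
Qed.

Lemma sqrt_iter_bound n x : nr (X n x) <= r n * nr x.
Proof.
elim: n x => [|n IH] x /=; first by rewrite mul0r (snorm0 hr).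
have [/andP[r0 r1] _] := sqrt_iter1_bounds n.
rewrite (snorm_scale hr) ?invr_ge0//.
have := snormD hr (A x) (X n (X n x)).
have := cA x; have := IH (X n x); have := ler_wpM2l r0 (IH x); lra.
Qed.

(** As the iterates commute, the difference of squares factors: the next increment is half of
    (X_{n+1} + X_n) applied to the current one, exactly as for the scalars. *)
Lemma sqrt_iter_incr n x :
  nr (X n.+1 x - X n x) <= (r n.+1 - r n) * nr x.
Proof.
elim: n x => [|n IH] x.
  rewrite /= subr0 addr0 expr0n /= addr0 mulr1 subr0.
  rewrite (snorm_scale hr) ?invr_ge0//.
  by rewrite ler_wpM2l// invr_ge0.
set D := X n.+1 x - X n x.
have -> : X n.+2 x - X n.+1 x = (2^-1)%:C *: (X n.+1 D + X n D).
  have -> : X n.+2 x - X n.+1 x = (2^-1)%:C *: (A x + X n.+1 (X n.+1 x)) -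
    (2^-1)%:C *: (A x + X n (X n x)) by [].
  rewrite -scalerBr opprD addrACA subrr add0r; congr (_ *: _).
  by rewrite /D !sqrt_iterB (sqrt_iter_comm n n.+1) addrA subrK.
have [/andP[r0 r1] _] := sqrt_iter1_bounds n.
have [/andP[s0 s1] _] := sqrt_iter1_bounds n.+1.
rewrite (snorm_scale hr) ?invr_ge0//.
have h1 := snormD hr (X n.+1 D) (X n D).
have h2 := sqrt_iter_bound n.+1 D; have h3 := sqrt_iter_bound n D.
have h4 := ler_wpM2l r0 (IH x); have h5 := ler_wpM2l s0 (IH x).
rewrite [r n.+2]/= -/(r n.+1).
have -> : 2^-1 * (1 + r n.+1 ^+ 2) - r n.+1 =
    2^-1 * (r n.+1 + r n) * (r n.+1 - r n) :> R by rewrite /=; field.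
rewrite -/D in h4 h5; lra.
Qed.

Lemma sqrt_iter_cauchy m n x : (n <= m)%N ->
  nr (X m x - X n x) <= (r m - r n) * nr x.
Proof.
elim: m => [|m IH].
  by rewrite leqn0 => /eqP ->; rewrite !subrr mul0r (snorm0 hr).
rewrite leq_eqVlt => /predU1P[->|/IH h].
  by rewrite !subrr mul0r (snorm0 hr).
have := snorm_dist hr (X m.+1 x) (X m x) (X n x).
by have := sqrt_iter_incr m x; lra.
Qed.

(** The strong limit of the iterates. Convergence at x has rate 2|x|/(n+1), so linearity, symmetry,
    the fixed-point equation and commutation pass to the limit with explicit errors. *)
Lemma contraction_sqrt : exists X : {linear H -> H},
  [/\ symmetric_map X, forall x, nr (X x) <= nr x,
      forall x, X (X x) = X x + X x - A x &
      forall C : {linear H -> H},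
        bounded_map C -> commutes A C -> commutes X C].
Proof.
have /choice[Y hY] : forall x, exists l, forall n,
    nr (X n x - l) <= 2 * nr x * recipS n.
  move=> x; apply: hilbert_complete_rate => m n; have nx := snorm_ge0 ri x.
  wlog le_nm : m n / (n <= m)%N.
    move=> W; have [/W//|/ltnW/W] := leqP n m.
    by rewrite (snormBC hr) [X in _ <= X -> _]addrC.
  apply: le_trans (sqrt_iter_cauchy x le_nm) _.
  have [/andP[_ ?] _] := sqrt_iter1_bounds m.
  have [_ ?] := sqrt_iter1_bounds n.
  have := recipS_gt0 R m; nra.
have Y1 x : nr (Y x) <= nr x.
  apply: (@le_of_recipS_bound _ _ _ (2 * nr x)) => n.
  have := snormB hr (X n x) (X n x - Y x); rewrite opprB addrC subrK => h.
  have [/andP[_ r1] _] := sqrt_iter1_bounds n.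
  have := sqrt_iter_bound n x; have := hY x n; have := snorm_ge0 ri x; nra.
have [L LY] : exists L : {linear H -> H}, L =1 Y.
  apply: linear_of_fun => a x y.
  apply/eqP; rewrite -subr_eq0; apply/eqP.
  pose z := a *: x + y.
  apply: (@nr_eq0_lim _ _ _
    (2 * nr z + complex.Re `|a| * (2 * nr x) + 2 * nr y)) => n.
  have -> : Y z - (a *: Y x + Y y) =
      (Y z - X n z) + (a *: (X n x - Y x) + (X n y - Y y)).
    rewrite [X n z]sqrt_iter_linear scalerBr.
    rewrite [X in _ = _ + X]addrACA -opprD addrA subrK//.
  have := snormD hr (Y z - X n z) (a *: (X n x - Y x) + (X n y - Y y)).
  have := snormD hr (a *: (X n x - Y x)) (X n y - Y y).
  rewrite (snormZ hr) (snormBC hr (Y z)).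
  have a0 : 0 <= complex.Re `|a|.
    by have := normr_ge0 a; rewrite lecE => /andP[].
  have := hY z n; have := ler_wpM2l a0 (hY x n); have := hY y n; lra.
exists L; split.
- move=> x y; rewrite !LY; apply/eqP; rewrite -subr_eq0 -normr_le0.
  apply: (@le_of_recipS_bound _ _ _ (4 * nr x * nr y)) => n; rewrite add0r.
  have -> : ri (Y x) y - ri x (Y y) =
      ri x (X n y - Y y) - ri (X n x - Y x) y.
    by rewrite (psdBl hr) (psdBr hr) sqrt_iter_symmetric; lra.
  apply: le_trans (ler_normB _ _) _.
  have := cauchy_schwarz_abs hr x (X n y - Y y).
  have := cauchy_schwarz_abs hr (X n x - Y x) y.
  have := ler_wpM2l (snorm_ge0 ri x) (hY y n).
  have := ler_wpM2r (snorm_ge0 ri y) (hY x n); lra.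
- by move=> x; rewrite LY.
- move=> x; rewrite !LY; apply/eqP; rewrite -subr_eq0; apply/eqP.
  apply: (@nr_eq0_lim _ _ _ (8 * nr x)) => n.
  (* Since 2 X_{n+1} = A + X_n^2, the defect of the fixed-point equation is a sum of three
     approximation errors. *)
  have -> : Y (Y x) - (Y x + Y x - A x) =
      ((Y (Y x) - X n (Y x)) + X n (Y x - X n x)) +
      (2 : R)%:C *: (X n.+1 x - Y x).
    rewrite /= scalerBr scalerA -rmorphM /= divff ?pnatr_eq0//.
    rewrite scale1r sqrt_iterB.
    have -> : (2 : R)%:C *: Y x = Y x + Y x.
      by rewrite rmorph_nat scaler_nat mulr2n.
    by rewrite [A x + _]addrC !addrA !subrK opprB addrA.
  have := snormD hr (Y (Y x) - X n (Y x) + X n (Y x - X n x))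
    ((2 : R)%:C *: (X n.+1 x - Y x)).
  have := snormD hr (Y (Y x) - X n (Y x)) (X n (Y x - X n x)).
  rewrite (snorm_scale hr)// [nr (Y (Y x) - _)](snormBC hr).
  have [/andP[r0 r1] _] := sqrt_iter1_bounds n.
  have := sqrt_iter_bound n (Y x - X n x); have := hY x n.
  rewrite (snormBC hr (X n x)) => h1 h2.
  have := ler_wpM2r (snorm_ge0 ri (Y x - X n x)) r1.
  have := hY (Y x) n; have := hY x n.+1; have := Y1 x.
  have := snorm_ge0 ri x; have := recipS_gt0 R n.
  have := recipS_le R (leqnSn n).
  nra.
- move=> C [M M0 hM] AC x; rewrite !LY; apply/eqP; rewrite -subr_eq0; apply/eqP.
  apply: (@nr_eq0_lim _ _ _ (4 * M * nr x)) => n.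
  have -> : Y (C x) - C (Y x) = (Y (C x) - X n (C x)) + C (X n x - Y x).
    by rewrite linearB /= (sqrt_iter_commute n AC) addrA subrK.
  have := snormD hr (Y (C x) - X n (C x)) (C (X n x - Y x)).
  have := hM (X n x - Y x); have := ler_wpM2l M0 (hY x n).
  have := hY (C x) n; rewrite (snormBC hr (Y (C x))).
  have := ler_wpM2r (ltW (recipS_gt0 R n)) (hM x); lra.
Qed.

End Iteration.

(** P = 1 - X, where X is the limit of the iteration for A = 1 - B. The root inherits both
    hypotheses on B, so roots can be taken repeatedly. *)
Lemma positive_sqrt (B : {linear H -> H}) :
  symmetric_map B -> (forall x, nr (x - B x) <= nr x) ->
  exists P : {linear H -> H},
    [/\ symmetric_map P, forall x, nr (x - P x) <= nr x,
        forall x, P (P x) = B x &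
        forall C : {linear H -> H},
          bounded_map C -> commutes B C -> commutes P C].
Proof.
move=> sB cB.
have [A hA] := linear_sub_id B.
have [] := @contraction_sqrt A.
- by move=> x y; rewrite !hA (psdBl hr) (psdBr hr) sB.
- by move=> x; rewrite hA.
move=> X [sX cX X2 XC]; have [P hP] := linear_sub_id X; exists P; split.
- by move=> x y; rewrite !hP (psdBl hr) (psdBr hr) sX.
- by move=> x; rewrite hP opprB addrC subrK.
- move=> x; rewrite !hP linearB /= X2 hA.
  set a := X x; have -> : a - (a + a - (x - B x)) = x - a - B x.
    by rewrite opprB addrC opprD addrA subrK addrAC.
  by rewrite subKr.
- move=> C bC BC x; rewrite !hP XC//; last by move=> y; rewrite !hA BC linearB.
  by rewrite linearB.
Qed.

End SquareRoot.

Lemma psd_comp (R : realType) (E : lmodType R[i]) (H : hilbertType R)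
    (L : {linear E -> H}) : psd (fun x y => rinner (L x) (L y)).
Proof.
have hr := @psd_rinner R H; split.
- by move=> x y z; rewrite linearD (psdDl hr).
- by move=> a x y; rewrite linearZ /= (psdZl hr).
- by move=> a x y; rewrite !linearZ /= (psdJ hr).
- by move=> x y; rewrite (psdC hr).
- by move=> x; rewrite (psd_ge0 hr).
Qed.

(** * Selfadjoint operators given by their graphs *)

Section GraphOperators.
Variables (R : realType) (H : hilbertType R).
Local Notation ri := (@rinner R H).
Local Notation nr := (snorm ri).
Local Notation hr := (@psd_rinner R H).

(** The difference v - w represents the zero functional with error e + d. *)
Lemma represents_unique (E : lmodType R[i]) (q : E -> E -> R) (f : E -> R)
    (v w : E) (e d : R) : psd q -> (forall y, f (- y) = - f y) ->
  0 <= e + d -> represents q f v e -> represents q f w d ->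
  snorm q (v - w) <= e + d.
Proof.
move=> hq fN ed0 hv hw; rewrite -[leRHS]add0r.
apply: (represents_snorm hq (representsB hq fN hv hw)); rewrite ?add0r//.
by move=> y; rewrite subrr mul0r.
Qed.

(** Approximate Riesz representatives of (g, P .) for the form (P x, P y) give vectors P v_n
    converging to some l, the projection of g on the closed range. Then l - g is orthogonal to the
    range, so P (l - g) = 0 and l = g. *)
Lemma dense_range_symmetric (P : {linear H -> H}) :
  symmetric_map P -> (forall x, P x = 0 -> x = 0) -> dense (range P).
Proof.
move=> sP iP; pose q x y := ri (P x) (P y).
have hq : psd q := psd_comp P.
apply/denseP => g e e0.
have /choice[v hv] n : exists v,
    represents q (fun y => ri g (P y)) v (recipS n).
  apply: (riesz_approx hq (C := nr g)) => [x y|a x|y|].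
  - by rewrite linearD (psdDr hr).
  - by rewrite linearZ /= (psdZr hr).
  - exact: (cauchy_schwarz hr).
  - exact: recipS_gt0.
have fN y : ri g (P (- y)) = - ri g (P y) by rewrite linearN (psdNr hr).
have [|l hl] := @hilbert_complete_rate _ H (P \o v) 1.
  move=> m n; rewrite !mul1r /= -linearB.
  by apply: (represents_unique hq fN) => //; rewrite addr_ge0// ltW ?recipS_gt0.
suff lg : l = g.
  have [n hn] : exists n, recipS n < e.
    apply: contrapT => /forallNP h; have : e <= 0; last by rewrite leNgt e0.
    apply: (@le_of_recipS_bound _ _ _ 1) => n.
    by rewrite add0r mul1r leNgt; apply/negP/h.
  exists (P (v n)); first by exists (v n).
  by apply: le_lt_trans hn; have := hl n; rewrite mul1r lg.
apply/eqP; rewrite -subr_eq0; apply/eqP/iP/nr_eq0; set z := P (l - g).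
apply/eqP; rewrite -sqrf_eq0 (sqr_snorm hr) eq_le (psd_ge0 hr) andbT.
apply: (@le_of_recipS_bound _ _ _ (2 * nr (P z))) => n; rewrite {1}/z sP.
have -> : ri (l - g) (P z) = (q (v n) z - ri g (P z)) - ri (P (v n) - l) (P z).
  by rewrite /q !(psdBl hr); lra.
have := hv n z; have := cauchy_schwarz_abs hr (P (v n) - l) (P z).
have := ler_wpM2r (snorm_ge0 ri (P z)) (hl n).
have := ler_norm (- ri (P (v n) - l) (P z)); rewrite normrN.
rewrite /= mul1r -[snorm q z]/(nr (P z)); lra.
Qed.

Lemma graph_operator (P Q : {linear H -> H}) : (forall x, P x = 0 -> x = 0) ->
  exists T : operator H, op_dom T = range P /\ forall z, T (P z) = Q z.
Proof.
move=> iP.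
(* g inverts P on its range and may take any value, here 0, elsewhere. *)
have /choice[g hg] (h : H) : exists z, (exists z', P z' = h) -> P z = h.
  have [[z hz]|n] := pselect (exists z', P z' = h); first by exists z.
  by exists 0.
have gP z : g (P z) = z.
  apply/eqP; rewrite -subr_eq0; apply/eqP/iP.
  by rewrite linearB /= hg ?subrr//; exists z.
have d0 : range P 0 by exists 0; rewrite ?linear0.
have dP (a : R[i]) x y : range P x -> range P y -> range P (a *: x + y).
  by move=> [u _ <-] [w _ <-]; exists (a *: u + w); rewrite ?linearP.
have lP (a : R[i]) x y : range P x -> range P y ->
    Q (g (a *: x + y)) = a *: Q (g x) + Q (g y).
  by move=> [u _ <-] [w _ <-]; rewrite -linearP !gP linearP.
by exists (Operator d0 dP lP); split=> // z /=; rewrite gP.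
Qed.

(** * Selfadjointness and positivity of the operator with graph {(P z, Q z)} *)

Section Selfadjoint.
Variables (P Q : {linear H -> H}) (T : operator H).
Hypotheses (sP : symmetric_map P) (sQ : symmetric_map Q) (PQ : commutes P Q).
Hypotheses (domT : op_dom T = range P) (TP : forall z, T (P z) = Q z).

(** A pair (u, v) in the adjoint graph satisfies Q u = P v, and the identity C P + D Q = 1 then
    recovers the parameter z = C u + D v with u = P z and v = Q z. *)
Lemma graph_selfadjoint (C D : H -> H) : (forall x, P x = 0 -> x = 0) ->
  commutes P C -> commutes P D -> commutes Q C -> commutes Q D ->
  (forall x, C (P x) + D (Q x) = x) -> selfadjoint T.
Proof.
move=> iP PC PD QC QD CD; split.
  by rewrite domT; exact: dense_range_symmetric.
apply/seteqP; split=> -[u v] /=.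
  move=> huv; have e : Q u = P v.
    apply/eqP; rewrite -subr_eq0; apply/eqP/rinner_eq0 => z.
    rewrite (psdBl hr) sQ sP (psdC hr u) (psdC hr v).
    have := huv (P z); rewrite domT TP => /(_ (ex_intro2 _ _ z I erefl)).
    by rewrite /rinner => ->; rewrite subrr.
  have eu : P (C u + D v) = u by rewrite linearD /= PC PD -e CD.
  have ev : Q (C u + D v) = v by rewrite linearD /= QC QD e CD.
  by split; [rewrite domT; exists (C u + D v) | rewrite -eu TP ev].
rewrite /op_graph /adjoint_graph /= domT => -[[z _ <-] <-] x [y _ <-].
rewrite !TP inner_symmetric// -PQ -inner_symmetric//.
Qed.

(** Only the imaginary part needs an argument: P and Q are symmetric and commute, so (Q z, P z)
    equals its own conjugate. *)
Lemma graph_positive : (forall z, 0 <= ri (Q z) (P z)) -> positive_op T.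
Proof.
move=> h x; rewrite domT => -[z _ <-]; rewrite TP.
rewrite lecE h andbT; set w := inner _ _.
have : w = Num.conj w.
  have e : w = Num.conj (inner (P z) (Q z)).
    by rewrite -[RHS]mul1r; exact: (hermC inner).
  rewrite {1}e; congr Num.conj.
  by rewrite inner_symmetric// PQ -inner_symmetric.
case: w => a b [] /eqP; rewrite -subr_eq0 opprK -mulr2n mulrn_eq0 /=.
by rewrite eq_sym.
Qed.

End Selfadjoint.

Lemma comp_graph_sqrt (B P Q : {linear H -> H}) (S T : operator H) :
  commutes P Q -> (forall x, P (P x) = B x) -> (forall x, Q (Q x) = x - B x) ->
  op_dom T = range P -> (forall z, T (P z) = Q z) ->
  op_dom S = range B -> (forall z, S (B z) = z - B z) ->
  comp_graph T T = op_graph S.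
Proof.
move=> PQ PP QQ dT TP dS SB; have one x : P (P x) + Q (Q x) = x.
  by rewrite PP QQ addrC subrK.
apply/seteqP; split=> -[u v] /=; rewrite /comp_graph /op_graph /= dT dS.
  move=> [[x _ <-]]; rewrite TP => -[y _ e]; rewrite -e TP => <-.
  (* Here u = P x, Q x = P y and v = Q y; as P^2 + Q^2 = 1, the vector z = P x + Q y satisfies P z =
     x and Q z = y, whence u = B z and v = z - B z. *)
  have eu : P (P x + Q y) = x by rewrite linearD /= PQ e one.
  have ev : Q (P x + Q y) = y by rewrite linearD /= -PQ -e one.
  have eB : B (P x + Q y) = P x by rewrite -PP eu.
  by split; [exists (P x + Q y) | rewrite -eB SB -QQ ev].
move=> [[z _ <-]]; rewrite SB => <-; rewrite -PP; split.
- by exists (P z).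
- by rewrite TP; exists (Q z); rewrite ?PQ.
- by rewrite TP -PQ TP QQ PP.
Qed.

End GraphOperators.

(** If h is nonzero, some x in A is closer to h than |h|, and then (h, x) > 0. *)
Lemma orthogonal_dense (R : realType) (H : hilbertType R) (A : set H) (h : H) :
  dense A -> (forall x, A x -> rinner h x <= 0) -> h = 0.
Proof.
have hr := @psd_rinner R H; move=> /denseP dA hA; apply: nr_eq0; apply/eqP.
rewrite eq_le snorm_ge0 andbT leNgt; apply/negP => h0.
have [x Ax hx] := dA h _ h0.
have := hA _ Ax; have := cauchy_schwarz hr h (h - x).
rewrite (psdBr hr) -(sqr_snorm hr) (snormBC hr).
by move: hx; rewrite -(ltr_pM2l h0); lra.
Qed.

(** * The resolvent of a form *)

(* The closed form obtained from [q] on [D] is handled through its resolvent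
   [B] at [-1], characterized by [q (B h) y = (h, j y)]; elements [v] of [D]
   with [represents q (fun y => (h, j y)) v e] stand for approximations of
   [B h] in the norm of [q]. *)
Section Resolvent.
Variables (R : realType) (D : lmodType R[i]) (H : hilbertType R).
Variables (q : D -> D -> R) (j : {linear D -> H}).
Local Notation ri := (@rinner R H).
Local Notation nr := (snorm ri).
Local Notation hr := (@psd_rinner R H).
Local Notation E := (snorm q).
Hypotheses (hq : psd q) (jq : forall y, nr (j y) <= E y).

Definition resolvent_at (h : H) (v : D) (e : R) :=
  represents q (fun y => ri h (j y)) v e.

Lemma resolvent_at_oddE h y : ri h (j (- y)) = - ri h (j y).
Proof. by rewrite linearN (psdNr hr). Qed.

Lemma resolvent_at_bound h y : ri h (j y) <= nr h * E y.
Proof.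
apply: le_trans (cauchy_schwarz hr _ _) _.
by rewrite ler_wpM2l ?snorm_ge0.
Qed.

Lemma resolvent_at_exists h (e : R) : 0 < e -> exists v, resolvent_at h v e.
Proof.
apply: (riesz_approx hq (C := nr h)) => [x y|a x|y].
- by rewrite linearD (psdDr hr).
- by rewrite linearZ /= (psdZr hr).
- exact: resolvent_at_bound.
Qed.

Lemma resolvent_at_snorm h v n : resolvent_at h v (recipS n) ->
  E v <= nr h + recipS n.
Proof.
move=> hv; apply: (represents_snorm hq hv); first exact: resolvent_at_bound.
by rewrite addr_ge0 ?snorm_ge0// ltW ?recipS_gt0.
Qed.

Lemma resolvent_at_rev h v e y : resolvent_at h v e ->
  ri h (j y) - q v y <= e * E y.
Proof.
move=> /(_ (- y)); rewrite resolvent_at_oddE (psdNr hq) (snormN hq); lra.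
Qed.

Definition is_resolvent (B : H -> H) := forall h v e, 0 <= e ->
  resolvent_at h v e -> nr (j v - B h) <= e.

(** Approximate representatives of (h, j .) with errors tending to 0 are Cauchy for q, so their
    images under j converge; uniqueness up to the errors makes the limit independent of choices and
    linear in h. *)
Lemma resolvent_exists : exists B : {linear H -> H}, is_resolvent B.
Proof.
have rn n : 0 < recipS n :> R by exact: recipS_gt0.
have /choice[B hB] h : exists b, forall v e, 0 <= e ->
    resolvent_at h v e -> nr (j v - b) <= e.
  have /choice[v hv] n := resolvent_at_exists h (rn n).
  have [|b hb] := @hilbert_complete_rate _ H (j \o v) 1.
    move=> m n; rewrite !mul1r /= -linearB; apply: le_trans (jq _) _.
    by apply: (represents_unique hq _ _ (hv m) (hv n)) => [y|];
      rewrite ?resolvent_at_oddE ?addr_ge0// ltW.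
  exists b => w e e0 hw; apply: (@le_of_recipS_bound _ _ _ 2) => n.
  have := snorm_dist hr (j w) (j (v n)) b; rewrite -linearB.
  have := hb n; have := jq (w - v n).
  have : E (w - v n) <= e + recipS n.
    by apply: (represents_unique hq _ _ hw (hv n)) => [y|];
      rewrite ?resolvent_at_oddE ?addr_ge0// ltW.
  rewrite mul1r /=; lra.
have [|L LB] := @linear_of_fun _ H B.
  move=> a h k; apply/eqP; rewrite -subr_eq0; apply/eqP.
  pose c := complex.Re `|a|.
  have c0 : 0 <= c by have := normr_ge0 a; rewrite lecE => /andP[].
  apply: (@nr_eq0_lim _ _ _ (2 * c + 2)) => n.
  have [v hv] := resolvent_at_exists h (rn n).
  have [w hw] := resolvent_at_exists k (rn n).
  have hs : resolvent_at (a *: h + k) (a *: v + w) (c * recipS n + recipS n).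
    move=> y; have := represents_linear hq a hv hw y.
    by rewrite [j (_ *: _)]linearZ /= -(psdJ hr) -(psdDl hr).
  have r0 := ltW (rn n).
  have e0 : 0 <= c * recipS n + recipS n by rewrite addr_ge0// mulr_ge0.
  have h1 := hB _ _ _ e0 hs.
  have h2 := ler_wpM2l c0 (hB _ _ _ r0 hv); have h3 := hB _ _ _ r0 hw.
  have -> : B (a *: h + k) - (a *: B h + B k) =
      (B (a *: h + k) - j (a *: v + w)) + (a *: (j v - B h) + (j w - B k)).
    rewrite scalerBr [X in _ = _ + X]addrACA -opprD.
    by rewrite [j (_ + _)]linearP addrA subrK.
  have := snormD hr (B (a *: h + k) - j (a *: v + w))
    (a *: (j v - B h) + (j w - B k)).
  have := snormD hr (a *: (j v - B h)) (j w - B k).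
  rewrite (snormZ hr) (snormBC hr (B _)) -/c; lra.
by exists L => h v e; rewrite LB; exact: hB.
Qed.

(** * Symmetry, bounds and injectivity of the resolvent *)

Section Properties.
Variable B : {linear H -> H}.
Hypothesis hB : is_resolvent B.

Lemma resolvent_approx h n : exists v,
  [/\ resolvent_at h v (recipS n), nr (j v - B h) <= recipS n &
      E v <= nr h + recipS n].
Proof.
have [v hv] := resolvent_at_exists h (recipS_gt0 R n); exists v; split=> //.
  by apply: hB => //; rewrite ltW ?recipS_gt0.
exact: resolvent_at_snorm.
Qed.

Lemma resolvent_symmetric : symmetric_map B.
Proof.
suff W h k : ri (B h) k <= ri h (B k).
  by move=> h k; apply/eqP; rewrite eq_le W (psdC hr) [leRHS](psdC hr) W.
apply: (@le_of_recipS_bound _ _ _ (2 * nr h + 2 * nr k + 2)) => n.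
have [v [v1 v2 v3]] := resolvent_approx h n.
have [w [w1 w2 w3]] := resolvent_approx k n.
have := cauchy_schwarz hr (B h - j v) k.
have := cauchy_schwarz hr h (j w - B k).
rewrite (psdBl hr) (psdBr hr) (snormBC hr (B h)) (psdC hr (j v)).
have := v1 w; have := resolvent_at_rev v w1; rewrite (psdC hq w).
have [r0 r1] := (recipS_gt0 R n, recipS_le1 R n).
have := ler_wpM2l (ltW r0) v3; have := ler_wpM2l (ltW r0) w3.
have := ler_wpM2r (snorm_ge0 ri k) v2; have := ler_wpM2l (snorm_ge0 ri h) w2.
have : recipS n * recipS n <= recipS n :> R by rewrite ger_pMr.
lra.
Qed.

(** Approximate form of q (B h) (B h) = (B h, h). *)
Lemma resolvent_form_le h n v : nr (j v - B h) <= recipS n ->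
  resolvent_at h v (recipS n) -> E v <= nr h + recipS n ->
  E v ^+ 2 <= ri (B h) h + (2 * nr h + 1) * recipS n.
Proof.
move=> v2 v1 v3; rewrite (sqr_snorm hq).
have [r0 r1] := (recipS_gt0 R n, recipS_le1 R n).
have : recipS n * recipS n <= recipS n :> R by rewrite ger_pMr.
have := v1 v; have := cauchy_schwarz hr h (j v - B h).
have := ler_wpM2l (snorm_ge0 ri h) v2; have := ler_wpM2l (ltW r0) v3.
rewrite (psdBr hr) (psdC hr h (B h)); lra.
Qed.

(** The norm of q dominates that of [H]; the inequality B^2 <= B contains 0 <= B <= 1. *)
Lemma resolvent_sqr_le h : nr (B h) ^+ 2 <= ri (B h) h.
Proof.
apply: (@le_of_recipS_bound _ _ _ (4 * nr h + 4)) => n.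
have [v [v1 v2 v3]] := resolvent_approx h n.
have h4 := resolvent_form_le v2 v1 v3.
have [r0 r1] := (recipS_gt0 R n, recipS_le1 R n).
have h5 : nr (B h) <= E v + recipS n.
  have := snormB hr (j v) (j v - B h); rewrite opprB addrC subrK.
  by have := jq v; lra.
have h6 : nr (B h) ^+ 2 <= (E v + recipS n) ^+ 2.
  by rewrite ler_sqr ?nnegrE ?snorm_ge0// addr_ge0 ?snorm_ge0// ltW.
have := ler_wpM2l (ltW r0) v3.
have : recipS n * recipS n <= recipS n :> R by rewrite ger_pMr.
by move: h6; rewrite sqrrD expr2 [recipS n ^+ 2]expr2; lra.
Qed.

Lemma resolvent_contraction h : nr (B h) <= nr h.
Proof.
rewrite -ler_sqr ?nnegrE ?snorm_ge0//.
have := psd_young hr (B h) h; rewrite -!(sqr_snorm hr).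
by have := resolvent_sqr_le h; lra.
Qed.

Lemma resolvent_coercive h : nr (h - B h) <= nr h.
Proof.
rewrite -ler_sqr ?nnegrE ?snorm_ge0// (sqr_snorm hr) (psdBl hr) !(psdBr hr).
rewrite -!(sqr_snorm hr) (psdC hr h (B h)).
by have := resolvent_sqr_le h; have := sqr_ge0 (nr (B h)); lra.
Qed.

(** Formally (k, j x) = q (B k) x, to which the Young inequality for q is applied. *)
Lemma resolvent_young k x : 2 * ri k (j x) <= q x x + ri (B k) k.
Proof.
apply: (@le_of_recipS_bound _ _ _ (2 * nr k + 1 + 2 * E x)) => n.
have [v [v1 v2 v3]] := resolvent_approx k n.
have := resolvent_form_le v2 v1 v3; rewrite (sqr_snorm hq).
by have := resolvent_at_rev x v1; have := psd_young hq v x; lra.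
Qed.

(* Closability of [q], in the form in which it is used: with rates. *)
Hypothesis closable : forall (u : nat -> D) (c : R),
  (forall n, nr (j (u n)) <= c * recipS n) ->
  (forall m n, E (u m - u n) <= c * recipS m + c * recipS n) ->
  forall n, E (u n) <= 2 * c * recipS n.

(** Approximants v_n of B h = 0 are Cauchy for q with j v_n tending to 0; closability makes them
    tend to 0 for q, so (h, j y) = lim q v_n y = 0. *)
Lemma resolvent_injective h : dense (range j) -> B h = 0 -> h = 0.
Proof.
move=> dj Bh; apply: (orthogonal_dense dj) => _ [y _ <-].
have /choice[v hv] n := resolvent_approx h n.
have Ev n : E (v n) <= 2 * 1 * recipS n.
  apply: closable => [{}n|m {}n]; rewrite !mul1r.
    by have [_ + _] := hv n; rewrite Bh subr0.
  have [[hm _ _] [hn _ _]] := (hv m, hv n).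
  apply: (represents_unique hq _ _ hm hn) => [z|].
    by rewrite resolvent_at_oddE.
  by rewrite addr_ge0// ltW ?recipS_gt0.
apply: (@le_of_recipS_bound _ _ _ (3 * E y)) => n; have [v1 _ _] := hv n.
have := resolvent_at_rev y v1; have := cauchy_schwarz hq (v n) y.
by have := ler_wpM2r (snorm_ge0 q y) (Ev n); lra.
Qed.

(** * The range of the square root of the resolvent contains the range of j *)

Section Lift.
Variable P : {linear H -> H}.
Hypotheses (sP : symmetric_map P) (PP : forall x, P (P x) = B x).
Hypothesis cP : forall x, nr (P x) <= 2 * nr x.

(** Optimizing [resolvent_young] over real multiples of x, with (B k, k) = |P k|^2. Thus (j x, .) is
    bounded for the form (P k, P l). *)
Lemma resolvent_sqrt_bound k x : ri (j x) k <= E x * nr (P k).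
Proof.
apply: young_optimal; rewrite ?snorm_ge0// => c.
have := resolvent_young k (c%:C *: x).
rewrite [j _]linearZ /= (psdZr hr) (psdZl hq) (psdZr hq) -PP sP (psdC hr k).
by rewrite (sqr_snorm hr) (sqr_snorm hq); lra.
Qed.

(* [w] is the image of [x] under the isometry from the completion of [(D, q)]
   onto [H] that maps the representative of [h] to [P h]. *)
Lemma resolvent_lift x : exists2 w, P w = j x &
  forall y w', P w' = j y -> ri w w' = q x y.
Proof.
pose p k l := ri (P k) (P l); have hp : psd p := psd_comp P.
have rn n : 0 < recipS n :> R by exact: recipS_gt0.
have oN k : ri (j x) (- k) = - ri (j x) k by exact: (psdNr hr).
have /choice[h hh] n : exists h, represents p (ri (j x)) h (recipS n).
  apply: (riesz_approx hp (C := E x)) => // [k l|a k|k].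
  - exact: (psdDr hr).
  - exact: (psdZr hr).
  - exact: resolvent_sqrt_bound.
have hP m n : nr (P (h m) - P (h n)) <= recipS m + recipS n.
  rewrite -linearB; apply: (represents_unique hp) => //.
  by rewrite addr_ge0// ltW.
have [|w hw] := @hilbert_complete_rate _ H (P \o h) 1.
  by move=> m n; rewrite !mul1r; exact: hP.
have Pw : P w = j x.
  apply/eqP; rewrite -subr_eq0; apply/eqP; set z := P w - j x.
  apply: nr_eq0; apply/eqP; rewrite -sqrf_eq0 (sqr_snorm hr).
  rewrite eq_le (psd_ge0 hr) andbT.
  apply: (@le_of_recipS_bound _ _ _ (2 * nr (P z))) => n.
  have -> : ri z z = (p (h n) z - ri (j x) z) - ri (P (h n) - w) (P z).
    by rewrite {1}/z !(psdBl hr) sP /p; lra.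
  have := hh n z; have := cauchy_schwarz_abs hr (P (h n) - w) (P z).
  have := ler_wpM2r (snorm_ge0 ri (P z)) (hw n).
  have := ler_norm (- ri (P (h n) - w) (P z)); rewrite normrN.
  rewrite /= mul1r -[snorm p z]/(nr (P z)); lra.
have /choice[v hv] n := resolvent_approx (h n) n.
(* v_n approximates B h_n = P (P h_n), whose limit is P w = j x. The constant 3 is 1 from v_n plus 2
   from the bound on P; closability doubles it. *)
have Ez n : E (x - v n) <= 2 * 3 * recipS n.
  apply: (closable (u := fun n => x - v n)) => [{}n|m {}n].
    have [_ v2 _] := hv n.
    have -> : j (x - v n) = (B (h n) - j (v n)) - P (P (h n) - w).
      rewrite [in LHS]linearB [in RHS]linearB /= -Pw PP opprB.
      by rewrite [RHS]addrC addrA subrK.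
    have := snormB hr (B (h n) - j (v n)) (P (P (h n) - w)).
    have := cP (P (h n) - w); have := hw n; rewrite mul1r /=.
    rewrite (snormBC hr (B _)); lra.
  have -> : x - v m - (x - v n) = v n - v m.
    by rewrite opprB addrC addrA subrK.
  have [[vm _ _] [vn _ _]] := (hv m, hv n).
  have hB' := representsB hq (resolvent_at_oddE (h m)) vn vm.
  have hC y : ri (h n) (j y) - ri (h m) (j y) <= (recipS m + recipS n) * E y.
    rewrite -(psdBl hr) (psdC hr).
    apply: le_trans (resolvent_sqrt_bound _ _) _; rewrite mulrC.
    by rewrite ler_wpM2r ?snorm_ge0// linearB [leRHS]addrC hP.
  have := represents_snorm hq hB' hC; have := rn m; have := rn n.
  by move=> n0 m0 /(_ _)/le_trans; apply; lra.
exists w => //.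
(* q x y is close to q v_n y, hence to (h_n, P w') = (P h_n, w'), which tends to (w, w'). The
   reverse inequality follows by changing the signs of y and w'. *)
have W y w' : P w' = j y -> q x y <= ri w w'.
  move=> hw'; apply: (@le_of_recipS_bound _ _ _ (7 * E y + nr w')) => n.
  have [v1 _ _] := hv n; have := v1 y; rewrite -hw' -sP.
  have := cauchy_schwarz hr (P (h n) - w) w'.
  have := ler_wpM2r (snorm_ge0 ri w') (hw n).
  have := cauchy_schwarz hq (x - v n) y.
  have := ler_wpM2r (snorm_ge0 q y) (Ez n).
  rewrite (psdBl hq) (psdBl hr) mul1r /=; lra.
move=> y w' hw'; apply/eqP; rewrite eq_le W// andbT.
have := W (- y) (- w'); rewrite !linearN hw' (psdNr hr) (psdNr hq) lerN2.
exact.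
Qed.

End Lift.
End Properties.
End Resolvent.

(** * Absolute continuity *)

Section AbsoluteContinuity.
Variables (R : realType) (D : lmodType R[i]) (s t : hermitian_form D).
Hypotheses (hs : nonneg_form s) (ht : nonneg_form t).
Variables (H : hilbertType R) (j : {linear D -> H}).
Hypothesis hj : is_form_completion t j.
Local Notation ri := (@rinner R H).
Local Notation nr := (snorm ri).
Local Notation hr := (@psd_rinner R H).

Let rs x y : R := complex.Re (s x y).
Let q x y : R := ri (j x) (j y) + rs x y.
Let psd_rs : psd rs := psd_hermitian hs.

Lemma psd_sum_form : psd q.
Proof.
have ht' := psd_comp j; split.
- by move=> x y z; rewrite /q (psdDl ht') (psdDl psd_rs) addrACA.
- by move=> a x y; rewrite /q (psdZl ht') (psdZl psd_rs) mulrDr.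
- by move=> a x y; rewrite /q (psdJ ht') (psdJ psd_rs).
- by move=> x y; rewrite /q (psdC ht') (psdC psd_rs).
- by move=> x; rewrite addr_ge0// ?(psd_ge0 psd_rs) ?(psd_ge0 ht').
Qed.

Lemma qf_target x : qf t x = nr (j x) ^+ 2.
Proof. by rewrite /qf -hj.1 (sqr_snorm hr). Qed.

Lemma qf_source x : qf s x = snorm rs x ^+ 2.
Proof. by rewrite (sqr_snorm psd_rs). Qed.

Lemma sqr_sum_snorm x : snorm q x ^+ 2 = nr (j x) ^+ 2 + snorm rs x ^+ 2.
Proof.
by rewrite (sqr_snorm psd_sum_form) (sqr_snorm hr) (sqr_snorm psd_rs).
Qed.

Lemma target_le_sum x : nr (j x) <= snorm q x.
Proof.
by rewrite -ler_sqr ?nnegrE ?snorm_ge0// sqr_sum_snorm lerDl sqr_ge0.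
Qed.

Lemma source_le_sum x : snorm rs x <= snorm q x.
Proof.
by rewrite -ler_sqr ?nnegrE ?snorm_ge0// sqr_sum_snorm lerDr sqr_ge0.
Qed.

(** * Absolute continuity as closability, with rates and through closed square roots *)

Section Closability.
Local Open Scope classical_set_scope.
Local Open Scope ring_scope.

Lemma abs_continuous_closable : abs_continuous s t ->
  forall (u : nat -> D) (c : R),
  (forall n, nr (j (u n)) <= c * recipS n) ->
  (forall m n, snorm q (u m - u n) <= c * recipS m + c * recipS n) ->
  forall n, snorm q (u n) <= 2 * c * recipS n.
Proof.
move=> ac u c hu hc.
have r0 : recipS n @[n --> \oo] --> (0 : R) by exact: cvg_harmonic.
have ut : qf t (u n) @[n --> \oo] --> (0 : R).
  have k : (c * recipS n) * (c * recipS n) @[n --> \oo] --> (c * 0) * (c * 0).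
    by apply: cvgM; apply: cvgM => //; exact: cvg_cst.
  rewrite !mulr0 in k.
  apply: (squeeze_cvgr _ (cvg_cst (0 : R)) k); near=> n.
  rewrite qf_target sqr_ge0 /= -expr2 ler_sqr ?nnegrE ?snorm_ge0//.
  by apply: le_trans (hu n); apply: snorm_ge0.
have us : qf s (u nm.1 - u nm.2) @[nm --> (\oo, \oo)] --> (0 : R).
  have k1 : recipS nm.1 @[nm --> (\oo, \oo)] --> (0 : R).
    exact: (cvg_comp _ _ cvg_fst r0).
  have k2 : recipS nm.2 @[nm --> (\oo, \oo)] --> (0 : R).
    exact: (cvg_comp _ _ cvg_snd r0).
  have k3 : c * recipS nm.1 + c * recipS nm.2 @[nm --> (\oo, \oo)] -->
      c * 0 + c * 0.
    by apply: cvgD; apply: cvgM => //; exact: cvg_cst.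
  rewrite mulr0 addr0 in k3.
  have k : (c * recipS nm.1 + c * recipS nm.2) *
      (c * recipS nm.1 + c * recipS nm.2) @[nm --> (\oo, \oo)] --> (0 * 0 : R).
    exact: cvgM.
  rewrite mulr0 in k.
  apply: (squeeze_cvgr _ (cvg_cst (0 : R)) k); near=> nm.
  rewrite qf_source sqr_ge0 /= -expr2 ler_sqr ?nnegrE ?snorm_ge0//.
  - exact: le_trans (source_le_sum _) (hc _ _).
  - by apply: le_trans (hc _ _); apply: snorm_ge0.
have lim := ac u ut us.
(* The limit carries no rate; one is obtained by letting the second index of the Cauchy estimate
   tend to infinity. *)
have su n : snorm rs (u n) <= c * recipS n.
  apply/ler_addgt0Pr => e e0; apply: (@le_of_recipS_bound _ _ _ c) => k.
  have /cvgrPdist_lt/(_ _ (exprn_gt0 2 e0))[N _ hN] := lim.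
  have := hN (maxn N k) (leq_maxl _ _).
  rewrite /= sub0r normrN qf_source ger0_norm ?sqr_ge0//.
  rewrite ltr_sqr ?nnegrE ?snorm_ge0 ?(ltW e0)// => h1.
  have c0 : 0 <= c.
    have := le_trans (snorm_ge0 _ _) (hu 0%N).
    by rewrite pmulr_lge0// recipS_gt0.
  have := ler_wpM2l c0 (recipS_le R (leq_maxr N k)).
  have := source_le_sum (u n - u (maxn N k)); have := hc n (maxn N k).
  have := snorm_dist psd_rs (u n) (u (maxn N k)) 0; rewrite !subr0; lra.
move=> n.
have a0 := snorm_ge0 ri (j (u n)); have b0 := snorm_ge0 rs (u n).
have := hu n; have := su n; set z := c * recipS n => h1 h2.
rewrite -mulrA -/z -ler_sqr ?nnegrE ?snorm_ge0 ?sqr_sum_snorm//; last lra.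
nra.
Unshelve. all: by end_near.
Qed.

(** T j u_n is Cauchy with limit l, and (x, l) = lim (T x, j u_n) = 0 for x in the dense domain of
    T, so l = 0. *)
Lemma closed_root_abs_continuous (T : operator H) :
  selfadjoint T -> (forall x, op_dom T (j x)) ->
  (forall x y, inner (T (j x)) (T (j y)) = s x y) -> abs_continuous s t.
Proof.
move=> [dT aT] domT Ts u ut us.
have symT x y : op_dom T x -> op_dom T y -> ri (T x) y = ri x (T y).
  move=> hx hy; have : op_graph T (y, T y) by [].
  by rewrite -aT => /(_ x hx) /=; rewrite /rinner => ->.
have nT x : nr (T (j x)) ^+ 2 = qf s x.
  by rewrite (sqr_snorm hr) /rinner Ts.
have TB x y : T (j x) - T (j y) = T (j (x - y)).
  have -> : j (x - y) = -1 *: j y + j x by rewrite linearB scaleN1r addrC.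
  by rewrite op_linear// scaleN1r addrC.
have [|l hl] := @hilbert_complete _ H (fun n => T (j (u n))).
  move=> e e0; have /cvgrPdist_lt/(_ _ (exprn_gt0 2 e0)) := us.
  move=> [[A B] /= [[N1 _ h1] [N2 _ h2]] hAB].
  exists (maxn N1 N2) => m hm.
  have := hAB (maxn N1 N2, m); rewrite /= sub0r normrN -nT -TB.
  rewrite ger0_norm ?sqr_ge0// ltr_sqr ?nnegrE ?snorm_ge0 ?(ltW e0)//; apply.
  split; [apply: h1; exact: leq_maxl | apply: h2].
  exact: leq_trans (leq_maxr _ _) hm.
have l0 : l = 0.
  apply: (orthogonal_dense dT) => x hx; rewrite (psdC hr).
  apply/ler_addgt0Pr => e e0; rewrite add0r.
  (* The two errors are at most (|x| + |T x|) e/c; the summand 1 keeps c positive. *)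
  pose c := nr x + nr (T x) + 1.
  have x0 := snorm_ge0 ri x; have Tx0 := snorm_ge0 ri (T x).
  have c0 : 0 < c by rewrite /c; lra.
  have d0 : 0 < e / c by rewrite divr_gt0.
  have [N hN] := hl _ d0.
  have /cvgrPdist_lt/(_ _ (exprn_gt0 2 d0))[M _ hM] := ut.
  have := hN _ (leq_maxl N M); have := hM _ (leq_maxr N M).
  set n := maxn N M; rewrite /= sub0r normrN qf_target ger0_norm ?sqr_ge0//.
  rewrite ltr_sqr ?nnegrE ?snorm_ge0 ?(ltW d0)// => /ltW k1 /ltW k2.
  have := cauchy_schwarz hr x (l - T (j (u n))).
  rewrite (psdBr hr) -symT// (snormBC hr l).
  have := cauchy_schwarz hr (T x) (j (u n)).
  have := ler_wpM2l x0 k2; have := ler_wpM2l Tx0 k1.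
  have ec : e = e / c * c by rewrite divfK ?gt_eqF.
  rewrite {3}ec; set d := e / c in d0 *; rewrite /c; lra.
apply/cvgrPdist_lt => e e0.
have e0' : 0 < Num.sqrt e by rewrite sqrtr_gt0.
have [N hN] := hl _ e0'; exists N => // n /hN /=.
rewrite l0 subr0 sub0r normrN -nT ger0_norm ?sqr_ge0// => h.
rewrite -[ltRHS](sqr_sqrtr (ltW e0)) ltr_sqr ?nnegrE ?snorm_ge0 ?sqrtr_ge0//.
Qed.

End Closability.

Lemma abs_continuous_operator : abs_continuous s t ->
  exists S : operator H, positive_selfadjoint S /\
    exists sqrtS : operator H,
      [/\ is_sqrt_op S sqrtS,
          (forall x : D, op_dom sqrtS (j x))
        & forall x y : D, inner (sqrtS (j x)) (sqrtS (j y)) = s x y].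
Proof.
move=> /abs_continuous_closable cl.
have [B hB] := resolvent_exists psd_sum_form target_le_sum.
have sB := resolvent_symmetric psd_sum_form target_le_sum hB.
have B1 := resolvent_contraction psd_sum_form target_le_sum hB.
have cB := resolvent_coercive psd_sum_form target_le_sum hB.
have iB h := resolvent_injective psd_sum_form target_le_sum hB cl hj.2 (h := h).
have [A hA] := linear_sub_id B.
have sA : symmetric_map A.
  by move=> x y; rewrite !hA (psdBl hr) (psdBr hr) sB.
have bounded2 (F : {linear H -> H}) :
    (forall x, nr (x - F x) <= nr x) -> forall x, nr (F x) <= 2 * nr x.
  move=> cF x; have := snormB hr x (x - F x); rewrite opprB addrC subrK.
  by have := cF x; lra.
have bm (F : {linear H -> H}) :
    (forall x, nr (x - F x) <= nr x) -> bounded_map F.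
  by move=> /bounded2 h; exists 2.
have positive (F : {linear H -> H}) :
    (forall x, nr (x - F x) <= nr x) -> forall x, 0 <= ri (F x) x.
  move=> cF x; have := cauchy_schwarz hr (x - F x) x.
  have := ler_wpM2r (snorm_ge0 ri x) (cF x).
  by rewrite (psdBl hr) -(sqr_snorm hr x) -expr2; lra.
have [P [sP cP PP CP]] := positive_sqrt sB cB.
have cA x : nr (x - A x) <= nr x by rewrite hA subKr.
have [Q [sQ cQ QQ CQ]] := positive_sqrt sA cA.
have PB : commutes P B by apply: CP => //; exact: bm.
have QP : commutes Q P.
  by apply: CQ; [exact: bm | move=> x; rewrite !hA linearB PB].
have PQ : commutes P Q by move=> x; rewrite QP.
have QQ' x : Q (Q x) = x - B x by rewrite QQ hA.
have one x : P (P x) + Q (Q x) = x by rewrite PP QQ' addrC subrK.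
have iP x : P x = 0 -> x = 0.
  by move=> Px; apply: iB; rewrite -PP Px linear0.
(* A root M of P commuting with Q gives (Q z, P z) = (Q M z, M z) >= 0, the positivity of T. *)
have [M [sM _ MM CM]] := positive_sqrt sP cP.
have MQ : commutes M Q by apply: CM => //; exact: bm.
have [T [domT TP]] := graph_operator Q iP.
have [S [domS SB]] := graph_operator A iB.
have BA : commutes B A by move=> x; rewrite !hA linearB.
exists S; split.
  split.
    apply: (graph_selfadjoint sB sA BA domS SB (C := id) (D := id)) => // x.
    by rewrite hA addrC subrK.
  apply: (graph_positive sB sA BA domS SB) => z.
  rewrite hA (psdBl hr) -(sqr_snorm hr) subr_ge0 (psdC hr z).
  exact: (resolvent_sqr_le psd_sum_form target_le_sum hB).
have lift x := resolvent_lift psd_sum_form target_le_sum hB cl sP PP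
  (bounded2 _ cP) x.
(* With j x = P w and j y = P w', (Q w, Q w') = (w, w') - (P w, P w') = q x y - (j x, j y). *)
have Ts x y : ri (T (j x)) (T (j y)) = rs x y.
  have [w hw Hw] := lift x; have [w' hw' _] := lift y.
  rewrite -hw -hw' !TP sQ QQ' (psdBr hr) -PP -sP hw hw' (Hw y)// /q.
  by rewrite addrC addKr.
exists T; split.
- split; first split.
  + exact: (graph_selfadjoint sP sQ PQ domT TP (C := P) (D := Q)).
  + apply: (graph_positive sP sQ PQ domT TP) => z.
    by rewrite -MM -sM MQ; exact: positive.
  + by apply: (comp_graph_sqrt PQ PP QQ' domT TP domS) => z; rewrite SB hA.
- by move=> x; rewrite domT; have [w hw _] := lift x; exists w.
- move=> x y; apply: complex_eq_Re; first exact: Ts.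
  have -> : 'i * inner (T (j x)) (T (j y)) = inner ('i *: T (j x)) (T (j y)).
    by rewrite -linearZl_LR.
  have -> : 'i * s x y = s ('i *: x) y by rewrite -linearZl_LR.
  rewrite -[RHS]Ts; congr (complex.Re (inner _ _)).
  have [w hw _] := lift x.
  by rewrite [j ('i *: x)]linearZ /= -hw -[_ *: P w]linearZ !TP linearZ.
Qed.

End AbsoluteContinuity.

Theorem theorem2p3 (R : realType) (D : lmodType R[i])
    (s t : hermitian_form D) (hs : nonneg_form s) (ht : nonneg_form t)
    (Ht : hilbertType R) (j : {linear D -> Ht})
    (hj : is_form_completion t j) :
  abs_continuous s t <->
  exists S : operator Ht, positive_selfadjoint S /\
    exists sqrtS : operator Ht,
      [/\ is_sqrt_op S sqrtS,
          (forall x : D, op_dom sqrtS (j x))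
        & forall x y : D, inner (sqrtS (j x)) (sqrtS (j y)) = s x y].
Proof.
split; first exact: abs_continuous_operator.
move=> [S [_ [T [[[sT _] _] domT Ts]]]].
exact: (closed_root_abs_continuous hj sT domT Ts).
Qed.
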